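(* Let $\varepsilon=(-1)^k$. Any sextuple of type $A(3k+1,0)$ ($k\ge 0$) and any sextuple of type $A(3k-1,0)$ ($k\ge1$) admits compatible $\varepsilon$-symmetric forms. With respect to standard bases there is a recursion providing compatible $\varepsilon$-symmetric forms with coefficients in the prime subfield of $\mathbf k$ (that is, a recursion constructing the coordinate matrices of such forms with respect to standard bases, all of whose entries lie in the prime subfield).
   Context: Standing assumptions: $\mathbf k$ is a perfect field with $\operatorname{char}\mathbf k\neq 2$; all vector spaces are finite-dimensional over $\mathbf k$. A sextuple $(V;C_i,I_i)$ in $V$ consists of subspaces $I_i\subseteq C_i\subseteq V$, $i=1,2,3$. An isomorphism of sextuples $(V;C_i,I_i)\to(V';C_i',I_i')$ is a linear bijection $f:V\to V'$ with $f(I_i)=I_i'$, $f(C_i)=C_i'$ for all $i$. For $\varepsilon=\pm1$, an $\varepsilon$-symmetric form is a bilinear form $B$ with $B(x,y)=\varepsilon B(y,x)$. A compatible $\varepsilon$-symmetric form for a sextuple is a non-degenerate $\varepsilon$-symmetric form $B$ on $V$ such that $C_i=I_i^{\perp}$ (orthogonal with respect to $B$) for $i=1,2,3$. Type $A(3k+1,0)$, $k\ge0$: a sextuple in a space $V$ having a basis $(e_1,\dots,e_{k+1},f_1,\dots,f_k,g_1,\dots,g_k)$ (called a standard basis) such that $I_1=\langle e_1-f_1,\dots,e_k-f_k\rangle$, $I_2=\langle g_1,\dots,g_k\rangle$, $I_3=\langle f_1-g_1,\dots,f_k-g_k\rangle$, $C_1=\langle e_1,\dots,e_{k+1},f_1,\dots,f_k\rangle$,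 $C_2=\langle e_1,\dots,e_{k+1},g_1,\dots,g_k\rangle$, $C_3=\langle e_1,e_2-f_1,\dots,e_{k+1}-f_k,f_1-g_1,\dots,f_k-g_k\rangle$. Type $A(3k-1,0)$, $k\ge1$: a sextuple in a space $V$ having a basis $(e_2,\dots,e_k,f_1,\dots,f_k,g_1,\dots,g_k)$ (called a standard basis) such that $I_1=\langle f_1,f_2-e_2,\dots,f_k-e_k\rangle$, $I_2=\langle g_1,\dots,g_k\rangle$, $I_3=\langle f_1-g_1,\dots,f_k-g_k\rangle$, $C_1=\langle e_2,\dots,e_k,f_1,\dots,f_k\rangle$, $C_2=\langle e_2,\dots,e_k,g_1,\dots,g_k\rangle$, $C_3=\langle f_1-e_2,\dots,f_{k-1}-e_k,f_1-g_1,\dots,f_k-g_k\rangle$. (These are, up to isomorphism, the unique indecomposable sextuples with their dimension vectors.) *)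

(* Defs.v *)
From HB Require Import structures.
From mathcomp Require Import all_boot all_algebra all_field.

Set Implicit Arguments.
Unset Strict Implicit.
Unset Printing Implicit Defensive.

Import GRing.Theory.
Local Open Scope ring_scope.

Definition perfect_field (F : fieldType) : Prop :=
  forall p : {poly F}, irreducible_poly p -> separable_poly p.

(* The least subset of F containing 1 and closed under subtraction and
   division, i.e. the intersection of all subfields; the case y = 0 of the last
   rule is harmless because x / 0 = 0. *)
Inductive prime_subfield (F : fieldType) : F -> Prop :=
| prime_subfield1 : prime_subfield 1
| prime_subfieldB x y :
    prime_subfield x -> prime_subfield y -> prime_subfield (x - y)
| prime_subfieldV x y :
    prime_subfield x -> prime_subfield y -> prime_subfield (x / y).

Record sextuple (F : fieldType) (V : vectType F) := Sextuple {
  sI1 : {vspace V}; sI2 : {vspace V}; sI3 : {vspace V};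
  sC1 : {vspace V}; sC2 : {vspace V}; sC3 : {vspace V};
  sIC1 : (sI1 <= sC1)%VS; sIC2 : (sI2 <= sC2)%VS; sIC3 : (sI3 <= sC3)%VS
}.

(* [{hermitian V for eps & idfun}] is the type of bilinear forms with
   B x y = (-1) ^+ eps * B y x; hence eps = odd k encodes the sign (-1)^k. *)
Definition compatible (F : fieldType) (V : vectType F) (eps : bool)
    (S : sextuple V) (B : {hermitian V for eps & idfun}) : Prop :=
  [/\ nondegenerate B, sC1 S = orthov B (sI1 S),
      sC2 S = orthov B (sI2 S) & sC3 S = orthov B (sI3 S)].

(* Standard bases are given by sequences e, f, g : nat -> V whose relevant terms
   are indexed from 1 (or 2) as in e_1, e_2, ...; the other terms are junk.
   [vecs a b v] is the list v a, v (a+1), ..., v b, empty if b < a. *)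
Definition vecs (T : Type) (a b : nat) (v : nat -> T) : seq T :=
  [seq v i | i <- index_iota a b.+1].

Definition basis_plus (T : Type) (k : nat) (e f g : nat -> T) : seq T :=
  vecs 1 k.+1 e ++ vecs 1 k f ++ vecs 1 k g.

Definition basis_minus (T : Type) (k : nat) (e f g : nat -> T) : seq T :=
  vecs 2 k e ++ vecs 1 k f ++ vecs 1 k g.

(* type A(3k+1,0) *)
Definition standard_plus (F : fieldType) (V : vectType F) (k : nat)
    (S : sextuple V) (e f g : nat -> V) : Prop :=
  [/\ basis_of fullv (basis_plus k e f g),
   [/\ sI1 S = <<vecs 1 k (fun i => e i - f i)>>%VS,
       sI2 S = <<vecs 1 k g>>%VS &
       sI3 S = <<vecs 1 k (fun i => f i - g i)>>%VS] &
   [/\ sC1 S = <<vecs 1 k.+1 e ++ vecs 1 k f>>%VS,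
       sC2 S = <<vecs 1 k.+1 e ++ vecs 1 k g>>%VS &
       sC3 S = <<e 1%N :: vecs 1 k (fun i => e i.+1 - f i)
                       ++ vecs 1 k (fun i => f i - g i)>>%VS]].

(* type A(3k-1,0) *)
Definition standard_minus (F : fieldType) (V : vectType F) (k : nat)
    (S : sextuple V) (e f g : nat -> V) : Prop :=
  [/\ basis_of fullv (basis_minus k e f g),
   [/\ sI1 S = <<f 1%N :: vecs 2 k (fun i => f i - e i)>>%VS,
       sI2 S = <<vecs 1 k g>>%VS &
       sI3 S = <<vecs 1 k (fun i => f i - g i)>>%VS] &
   [/\ sC1 S = <<vecs 2 k e ++ vecs 1 k f>>%VS,
       sC2 S = <<vecs 2 k e ++ vecs 1 k g>>%VS &
       sC3 S = <<vecs 1 k.-1 (fun i => f i - e i.+1)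
                 ++ vecs 1 k (fun i => f i - g i)>>%VS]].

Definition type_plus (F : fieldType) (V : vectType F) (k : nat)
    (S : sextuple V) : Prop := exists e f g, standard_plus k S e f g.

Definition type_minus (F : fieldType) (V : vectType F) (k : nat)
    (S : sextuple V) : Prop := exists e f g, standard_minus k S e f g.

(* A recursion for a sequence of square matrices M_0, M_1, ... is a single finite
   expression which, for all k, i and j, gives the (i, j) entry of M_k in terms
   of finitely many entries of the preceding matrices.  A mere function sending
   the preceding matrices to the next one would not do: every sequence of
   matrices is generated by such a function. *)
Inductive index_expr : Type :=
| IxStep                                 (* k *)
| IxRow                                  (* i *)
| IxCol                                  (* j *)
| IxNum of nat
| IxAdd of index_expr & index_expr
| IxSub of index_expr & index_expr.      (* truncated *)

Inductive recursion : Type :=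
| RInt of int
| RAdd of recursion & recursion
| ROpp of recursion
| RMul of recursion & recursion
| RInv of recursion
| RIfLe of index_expr & index_expr & recursion & recursion
| RPrev of nat & index_expr & index_expr.
    (* RPrev d a b is the (a, b) entry of M_(k-1-d), and is 0 when k <= d or
       when (a, b) is out of range. *)

Fixpoint index_eval (k i j : nat) (a : index_expr) : nat :=
  match a with
  | IxStep => k
  | IxRow => i
  | IxCol => j
  | IxNum n => n
  | IxAdd b c => index_eval k i j b + index_eval k i j c
  | IxSub b c => index_eval k i j b - index_eval k i j c
  end%N.

(* h lists M_(k-1), M_(k-2), ..., M_0 as functions of two indices from 0. *)
Fixpoint rec_eval (F : fieldType) (h : seq (nat -> nat -> F)) (k i j : nat)
    (r : recursion) : F :=
  match r with
  | RInt z => z%:~R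
  | RAdd s t => rec_eval h k i j s + rec_eval h k i j t
  | ROpp s => - rec_eval h k i j s
  | RMul s t => rec_eval h k i j s * rec_eval h k i j t
  | RInv s => (rec_eval h k i j s)^-1
  | RIfLe a b s t =>
      if (index_eval k i j a <= index_eval k i j b)%N
      then rec_eval h k i j s else rec_eval h k i j t
  | RPrev d a b =>
      nth (fun _ _ => 0) h d (index_eval k i j a) (index_eval k i j b)
  end.

(* dim k is the size of M_k. *)
Fixpoint rec_history (F : fieldType) (dim : nat -> nat) (r : recursion)
    (k : nat) : seq (nat -> nat -> F) :=
  if k is l.+1 then
    let h := rec_history F dim r l in
    (fun i j => if (i < dim l)%N && (j < dim l)%N
                then rec_eval h l i j r else 0) :: h
  else [::].

Definition rec_mx (F : fieldType) (dim : nat -> nat) (r : recursion)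
    (k : nat) : 'M[F]_(dim k) :=
  \matrix_(i, j) rec_eval (rec_history F dim r k) k i j r.

Definition dim_plus (k : nat) : nat := (3 * k + 1)%N.
Definition dim_minus (k : nat) : nat := (3 * k - 1)%N.

Definition coordinate_matrix (F : fieldType) (V : vectType F) (n : nat)
    (B : V -> V -> F) (b : seq V) (M : 'M[F]_n) : Prop :=
  size b = n /\ forall i j : 'I_n, B b`_i b`_j = M i j.

(* Main.v *)
Require Import Defs.
From HB Require Import structures.
From mathcomp Require Import all_boot all_algebra all_field.
From mathcomp Require Import zify ring.

(** Why the theorem holds.  Write A(i, j) = B(e_i, e_j).  Orthogonality of I_1
    and C_1 says that f_i pairs with the e_j and f_j exactly as e_i does, that
    of I_2 and C_2 says that g_i is orthogonal to all e_j and g_j, and that of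
    I_3 and C_3 then amounts to
      B(g_i, f_j) = A(i+1, j),  B(f_i, g_j) = A(i, j+1),
      A(i, j) = A(i+1, j) + A(i, j+1),
    with the convention A(0, j) = A(i, 0) = 0.  So a compatible form of sign
    (-1)^k arises from any array with indices 1, ..., k+1 which has that
    symmetry, satisfies this Pascal-like recurrence for i, j <= k, and makes
    the form nondegenerate.  The recurrence and the zero border force
    A(i, j) = 0 for i + j <= k+1 and alternating signs on the antidiagonal
    i + j = k+2 (this is where the sign (-1)^k comes from); if the entries
    there are nonzero, then the array is triangular and everything that has
    to be invertible is ([array_triangular]).

    Both types are served by the same array.  In type A(3k-1,0) the vectors
    e_1 and e_{k+1} are missing, but apart from the corner A(k+1, k+1) the
    first and last rows and columns of A still occur as values on the vectors
    f and g.

    The arrays A_k are built by a recursion of depth two: A_{k-2}, moved one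
    step along the diagonal and bordered by zeros, fills the indices up to k
    of A_k.  The recurrence then gives the row and the column of index k+1,
    except that at its end it only fixes A(k+1, k) + A(k, k+1), for which the
    symmetry asks to take halves, and says nothing about the corner, which is
    taken to be 0.  The lemmas [array_sym], [array_rec] and
    [array_antidiag_neq0] carry this part, and [rec_gramE] says that one
    finite expression generates the resulting coordinate matrices.

    Given the array, the inclusions of C_i in the orthogonal of I_i are
    computations with basis vectors.  For the converse, a vector orthogonal to
    I_1 or I_2 has zero coefficients on the g or on the f by triangularity;
    for I_3 triangularity applies to the sums of the coefficients of e_i,
    f_{i-1} and g_{i-1}.  The same vanishing statements give
    nondegeneracy. *)

Set Implicit Arguments.
Unset Strict Implicit.
Unset Printing Implicit Defensive.

Import GRing.Theory.
Local Open Scope ring_scope.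

(** * The array of values on the vectors e *)

Section Array.

Variable F : fieldType.

(** The array proper has indices from 1 to k+1; the row and column of index 0
    are its zero border.  The last row and column are split into the part
    read off from the recurrence and the half next to the corner. *)
Fixpoint array (k i j : nat) : F :=
  match k with
  | 0 => ((i == 1%N) && (j == 1%N))%:R
  | 1 => ((i == 1%N) && (j == 2%N))%:R - ((i == 2%N) && (j == 1%N))%:R
  | l.+2 =>
    if (i <= l.+2)%N then
      if (j <= l.+2)%N then array l i.-1 j.-1
      else array l i.-1 l.+1 -
        (if (i <= l.+1)%N then array l i l.+1 else array l l.+1 l.+1 / 2)
    else
      if (j <= l.+2)%N then array l l.+1 j.-1 -
        (if (j <= l.+1)%N then array l l.+1 j else array l l.+1 l.+1 / 2)
      else 0
  end.

Lemma nat_ind2 (P : nat -> Prop) :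
  P 0 -> P 1 -> (forall k, P k -> P k.+2) -> forall k, P k.
Proof.
move=> P0 P1 PSS k; suff [] : P k /\ P k.+1 by [].
by elim: k => // k [Pk PSk]; split; last exact: PSS.
Qed.

Lemma array_sym k i j : array k j i = (-1) ^+ odd k * array k i j.
Proof.
elim/nat_ind2: k i j => [||k IHk] i j /=.
- by rewrite mul1r andbC.
- by rewrite mulN1r opprB ![(j == _) && _]andbC.
rewrite negbK; case: ifP => _; case: ifP => _ //; last by rewrite mulr0.
- by rewrite mulrBr; case: ifP => _; rewrite ?mulrA -!IHk.
- by rewrite mulrBr; case: ifP => _; rewrite ?mulrA -!IHk.
Qed.

Lemma array0l k j : array k 0 j = 0.
Proof.
elim/nat_ind2: k j => [||k IHk] j //=; first by rewrite subr0.
by rewrite !IHk subrr if_same.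
Qed.

Lemma array0r k i : array k i 0 = 0.
Proof. by rewrite array_sym array0l mulr0. Qed.

(** The inner part is the recurrence for A_{k-2}, which applies up to its zero
    border; for i = k or j = k the last row or column was defined so as to
    make it true, and at (k, k) two halves add up. *)
Lemma array_rec (two_neq0 : 2%:R != 0 :> F) k i j :
  (i <= k)%N -> (j <= k)%N ->
  array k i j = array k i.+1 j + array k i j.+1.
Proof.
elim/nat_ind2: k i j => [||k IHk] i j.
- by rewrite !leqn0 => /eqP-> /eqP->; rewrite /= addr0.
- by move: i j => [|[|//]] [|[|//]] _ _ /=; ring.
rewrite leq_eqVlt [(j <= _)%N]leq_eqVlt => /predU1P[-> | lti] /predU1P[-> | ltj].
- by rewrite /= leqnn !ltnn /=; field.
- by rewrite /= leqnn !ltnn ltj (ltnW ltj) -[(j <= _)%N]ltnS ltj ?ltnn; ring.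
- by rewrite /= leqnn !ltnn lti (ltnW lti) -[(i <= _)%N]ltnS lti ?ltnn; ring.
rewrite /= lti ltj (ltnW lti) (ltnW ltj).
case: i lti => [|i] lti; case: j ltj => [|j] ltj /=; rewrite ?array0l ?array0r ?addr0 //.
exact: IHk.
Qed.

(** The recurrence read on the zero row. *)
Lemma array_row1 (two_neq0 : 2%:R != 0 :> F) k j : (j <= k)%N -> array k 1 j = 0.
Proof. by move=> lejk; have := array_rec two_neq0 (leq0n k) lejk; rewrite !array0l addr0. Qed.

Lemma array_eq0 (two_neq0 : 2%:R != 0 :> F) k i j :
  (i + j <= k.+1)%N -> array k i j = 0.
Proof.
case: i => [|i]; first by rewrite array0l.
elim: i j => [|i IHi] j leijk; first by apply: array_row1 => //; lia.
have [-> | j_gt0] := posnP j; first exact: array0r.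
have := array_rec two_neq0 (_ : i.+1 <= k)%N (_ : j <= k)%N.
rewrite !IHi ?addr0; try lia.
by move=> <- //; lia.
Qed.

(** Just above the antidiagonal the array vanishes, so the recurrence makes
    consecutive antidiagonal entries opposite; the first one is +1 or -1 by
    construction. *)
Lemma array_antidiag_neq0 (two_neq0 : 2%:R != 0 :> F) k i j :
  (0 < i)%N -> (0 < j)%N -> (i + j = k.+2)%N -> array k i j != 0.
Proof.
case: i => // i _; elim: i j => [|i IHi] j j_gt0 eq_ij.
  have -> : j = k.+1 by lia.
  elim/nat_ind2: k {j_gt0 eq_ij} => [||k IHk] /=; rewrite ?subr0 ?oner_eq0 //.
  by rewrite ltnn array0l sub0r oppr_eq0.
have := array_rec two_neq0 (_ : i.+1 <= k)%N (_ : j <= k)%N.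
rewrite array_eq0 //; last by lia.
move=> /(_ _ _)/esym/eqP; rewrite addr_eq0 => /(_ _ _)/eqP->; try lia.
by rewrite oppr_eq0 IHi //; lia.
Qed.

(** Column j of the array starts at row k+2-j, so the columns j0, j0+1, ...
    successively kill the entries of w from the bottom up, once w is known to
    vanish below the first of them. *)
Lemma array_triangular (two_neq0 : 2%:R != 0 :> F) k j0 j1 (w : nat -> F) :
    (0 < j0)%N -> (forall i, (k.+2 - j0 < i)%N -> w i = 0) ->
    (forall j, (j0 <= j <= j1)%N -> \sum_(1 <= i < k.+2) w i * array k i j = 0) ->
  forall i, (k.+2 - j1 <= i)%N -> (0 < i)%N -> w i = 0.
Proof.
move=> j0_gt0 w0 sum0 i.
have [n] := ubnP (k.+2 - i); elim: n i => // n IHn i lt_n lei i_gt0.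
have [le_i | /w0//] := leqP i (k.+2 - j0).
have i_in : i \in index_iota 1 k.+2 by rewrite mem_index_iota; lia.
have := sum0 (k.+2 - i)%N; rewrite (bigD1_seq i) ?iota_uniq //=.
rewrite big1_seq => [/(_ _)/eqP | i' /andP[ne_i']].
  rewrite addr0 mulf_eq0 (negPf (array_antidiag_neq0 _ _ _ _)) ?orbF //; try lia.
  by move=> /(_ _)/eqP-> //; lia.
rewrite mem_index_iota => range_i'; have [lt_i' | lt_i'] : (i' < i \/ i < i')%N by lia.
  by rewrite array_eq0 ?mulr0 //; lia.
by rewrite IHn ?mul0r //; lia.
Qed.

End Array.

(** * The recursion for the coordinate matrices *)

Inductive label := Le of nat | Lf of nat | Lg of nat.

Definition gram (F : fieldType) (k : nat) (l m : label) : F :=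
  match l, m with
  | Lg _, Lg _ | Lg _, Le _ | Le _, Lg _ => 0
  | Lg i, Lf j => array F k i.+1 j
  | Lf i, Lg j => array F k i j.+1
  | (Le i | Lf i), (Le j | Lf j) => array F k i j
  end.

(** From here on the boolean s is false for type A(3k+1,0) and true for type
    A(3k-1,0): the dimension is 3k+1-2s, and the vectors e_i are those with
    s < i <= k+1-s. *)
Definition dim_of (s : bool) : nat -> nat := if s then dim_minus else dim_plus.

Definition label_at (s : bool) (k p : nat) : label :=
  if (p < k.+1 - s.*2)%N then Le (p + s.+1)
  else if (p < k.*2.+1 - s.*2)%N then Lf (p + s.*2 - k)
  else Lg (p + s.*2 - k.*2).

Definition REq (x y : index_expr) (r : recursion) : recursion :=
  RIfLe x y (RIfLe y x r (RInt 0)) (RInt 0).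

(** The (x, y) entry of A_{k-2}, read from the matrix of step k-2.  In type
    A(3k-1,0) the vectors e do not show the border of the array, so the entry
    is taken from the values B(f_x, g_{y-1}) and B(g_{x-1}, f_y), which cover
    everything but the corners (1, 1) and (k-1, k-1).  These are 0, except
    that A_0 has the single entry 1; this also avoids the matrix of step 0,
    which in type A(3k-1,0) is empty.  Counted from 0, the vectors f_z and g_z
    of step k' stand at the places k'+z-2s and 2k'+z-2s. *)
Definition array_prev (s : bool) (x y : index_expr) : recursion :=
  let k' := IxSub IxStep (IxNum 2) in
  let one := IxNum 1 in
  let posf z := IxSub (IxAdd k' z) (IxNum s.*2) in
  let posg z := IxSub (IxAdd k' (IxAdd k' (IxSub z one))) (IxNum s.*2) in
  let gf := RIfLe (IxNum 2) x (RIfLe y k' (RPrev 1 (posg x) (posf y)) (RInt 0))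
              (RInt 0) in
  let fg := RPrev 1 (posf x) (posg y) in
  RIfLe one x
    (RIfLe one y
       (RIfLe IxStep (IxNum 2) (RInt 1)
          (RIfLe (IxNum 2) y (RIfLe x k' fg gf) gf))
       (RInt 0))
    (RInt 0).

Definition array_expr (s : bool) (x y : index_expr) : recursion :=
  let k := IxStep in
  let k1 := IxSub k (IxNum 1) in
  let pred z := IxSub z (IxNum 1) in
  let half r := RMul r (RInv (RInt 2)) in
  let corner := half (array_prev s k1 k1) in
  RIfLe k (IxNum 0) (REq x (IxNum 1) (REq y (IxNum 1) (RInt 1)))
  (RIfLe k (IxNum 1)
     (RAdd (REq x (IxNum 1) (REq y (IxNum 2) (RInt 1)))
           (ROpp (REq x (IxNum 2) (REq y (IxNum 1) (RInt 1)))))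
  (RIfLe x k
     (RIfLe y k (array_prev s (pred x) (pred y))
        (RAdd (array_prev s (pred x) k1)
              (ROpp (RIfLe x k1 (array_prev s x k1) corner))))
     (RIfLe y k
        (RAdd (array_prev s k1 (pred y))
              (ROpp (RIfLe y k1 (array_prev s k1 y) corner)))
        (RInt 0)))).

Definition gram_expr (s : bool) : recursion :=
  let twice z := IxAdd z z in
  let s1 := IxNum s.+1 in
  let s2 := IxNum s.*2 in
  let succ z := IxAdd z (IxNum 1) in
  let case_label z re rf rg :=
    RIfLe (succ z) (IxSub (succ IxStep) s2) (re (IxAdd z s1))
    (RIfLe (succ z) (IxSub (succ (twice IxStep)) s2)
       (rf (IxSub (IxAdd z s2) IxStep))
       (rg (IxSub (IxAdd z s2) (twice IxStep)))) in
  let zero _ := RInt 0 in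
  case_label IxRow
    (fun i => case_label IxCol (array_expr s i) (array_expr s i) zero)
    (fun i => case_label IxCol (array_expr s i) (array_expr s i)
                (fun j => array_expr s i (succ j)))
    (fun i => case_label IxCol zero (array_expr s (succ i)) zero).

Section Recursion.

Variable F : fieldType.

(** The matrix M shows the expected values of B(f_i, g_j) and B(g_i, f_j) at
    the places where [array_prev] looks for them. *)
Definition fg_blocks (s : bool) (k : nat) (M : nat -> nat -> F) : Prop :=
  forall i j : nat, (0 < i <= k)%N -> (0 < j <= k)%N ->
    M (k + i - s.*2)%N (k.*2 + j - s.*2)%N = array F k i j.+1 /\
    M (k.*2 + i - s.*2)%N (k + j - s.*2)%N = array F k i.+1 j.

(** The choice made for the corner entry, which fails for A_0 only. *)
Lemma array_corner k : array F k.+1 k.+2 k.+2 = 0.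
Proof. by case: k => [|k] /=; rewrite ?subrr ?ltnn. Qed.

Lemma array_prevE (two_neq0 : 2%:R != 0 :> F) (s : bool)
    (h : seq (nat -> nat -> F)) k i j x y :
    fg_blocks s k (nth (fun _ _ => 0) h 1) ->
    (index_eval k.+2 i j x <= k.+1)%N -> (index_eval k.+2 i j y <= k.+1)%N ->
  rec_eval h k.+2 i j (array_prev s x y)
    = array F k (index_eval k.+2 i j x) (index_eval k.+2 i j y).
Proof.
move=> blocks; cbn -[addn subn double leq array].
move: (index_eval _ _ _ x) (index_eval _ _ _ y) => a b le_a le_b.
have [-> | a_gt0] := posnP a; first by rewrite array0l.
have [-> | b_gt0] := posnP b; first by rewrite array0r.
rewrite (_ : k.+2 - 2 = k)%N; last by lia.
case: leqP => [gt_k | le_k]; last first.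
  have [-> [-> ->]] : (k = 0 /\ a = 1 /\ b = 1)%N by lia.
  by [].
rewrite !addnA !addnn.
have gfE : (1 < a)%N -> (b <= k)%N ->
    nth (fun _ _ => 0) h 1 (k.*2 + (a - 1) - s.*2)%N (k + b - s.*2)%N = array F k a b.
  move=> a_gt1 b_lek; have a1_range : (0 < a - 1 <= k)%N by lia.
  have b_range : (0 < b <= k)%N by lia.
  by have [_ ->] := blocks _ _ a1_range b_range; rewrite subn1 prednK.
have fgE : (1 < b)%N -> (a <= k)%N ->
    nth (fun _ _ => 0) h 1 (k + a - s.*2)%N (k.*2 + (b - 1) - s.*2)%N = array F k a b.
  move=> b_gt1 a_lek; have b1_range : (0 < b - 1 <= k)%N by lia.
  have a_range : (0 < a <= k)%N by lia.
  by have [-> _] := blocks _ _ a_range b1_range; rewrite subn1 prednK.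
have zeroE : (a <= 1 /\ b <= 1 \/ k < a /\ k < b)%N -> 0%:~R = array F k a b.
  case=> [[le_a1 le_b1]|[gt_a gt_b]]; first by rewrite array_eq0 //; lia.
  have [-> ->] : a = k.+1 /\ b = k.+1 by lia.
  by case: (k) gt_k => // l _; rewrite array_corner.
by have [b1|b1] := leqP b 1; have [ak|ak] := leqP a k; have [a1|a1] := leqP a 1;
  have [bk|bk] := leqP b k; rewrite ?fgE ?gfE //; apply: zeroE; lia.
Qed.

Lemma array_exprE (two_neq0 : 2%:R != 0 :> F) (s : bool)
    (h : seq (nat -> nat -> F)) k i j x y :
    fg_blocks s (k - 2) (nth (fun _ _ => 0) h 1) ->
    (index_eval k i j x <= k.+1)%N -> (index_eval k i j y <= k.+1)%N ->
  rec_eval h k i j (array_expr s x y)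
    = array F k (index_eval k i j x) (index_eval k i j y).
Proof.
case: k => [|[|k]] blocks.
- cbn -[addn subn double leq array array_prev].
  set a := index_eval _ _ _ x; set b := index_eval _ _ _ y.
  by move: a b => [|[|//]] [|[|//]].
- cbn -[addn subn double leq array array_prev].
  set a := index_eval _ _ _ x; set b := index_eval _ _ _ y.
  by move: a b => [|[|[|//]]] [|[|[|//]]] //= _ _; rewrite ?oppr0 ?addr0 ?add0r ?subr0.
rewrite subSS subSS subn0 in blocks.
have prevE u v := @array_prevE two_neq0 s h k i j u v blocks.
cbn -[addn subn double leq array array_prev].
have k1E : (k.+2 - 1 = k.+1)%N by lia.
have twoE : (1 *+ 2 : int)%:~R = 2%:R :> F by [].
rewrite k1E twoE ltn0 [(_ < 1)%N]ltnS ltn0 => le_x le_y.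
have prev_evalE u v a b : index_eval k.+2 i j u = a -> index_eval k.+2 i j v = b ->
    (a <= k.+1)%N -> (b <= k.+1)%N ->
    rec_eval h k.+2 i j (array_prev s u v) = array F k a b.
  by move=> <- <-; exact: prevE.
have predE z : index_eval k.+2 i j (IxSub z (IxNum 1)) = (index_eval k.+2 i j z).-1.
  exact: subn1.
have stepE : index_eval k.+2 i j (IxSub IxStep (IxNum 1)) = k.+1 by exact: k1E.
rewrite (prev_evalE _ _ _ _ stepE stepE) // [RHS]/=.
case: leqP => x2; case: leqP => y2 //.
- by rewrite (prev_evalE _ _ _ _ (predE x) (predE y)) //; lia.
- rewrite (prev_evalE _ _ _ _ (predE x) stepE) //; last by lia.
  by case: leqP => x1 //; rewrite (prev_evalE _ _ _ _ erefl stepE).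
rewrite (prev_evalE _ _ _ _ stepE (predE y)) //; last by lia.
by case: leqP => y1 //; rewrite (prev_evalE _ _ _ _ stepE erefl).
Qed.
Lemma dim_ofE (s : bool) k : dim_of s k = (3 * k + 1 - s.*2)%N.
Proof. by case: s; rewrite /= /dim_minus /dim_plus; lia. Qed.

Lemma gram_exprE (two_neq0 : 2%:R != 0 :> F) (s : bool)
    (h : seq (nat -> nat -> F)) k p q :
    fg_blocks s (k - 2) (nth (fun _ _ => 0) h 1) -> (s <= k)%N ->
    (p < dim_of s k)%N -> (q < dim_of s k)%N ->
  rec_eval h k p q (gram_expr s) = gram F k (label_at s k p) (label_at s k q).
Proof.
move=> blocks le_sk; rewrite dim_ofE => lt_p lt_q.
have arrayE x y a b : index_eval k p q x = a -> index_eval k p q y = b ->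
    (a <= k.+1)%N -> (b <= k.+1)%N ->
    rec_eval h k p q (array_expr s x y) = array F k a b.
  by move=> <- <-; exact: array_exprE.
cbn -[addn subn double leq array array_expr gram].
rewrite /label_at !addn1 !addnn.
by case: ltnP => p1; [|case: ltnP => p2]; (case: ltnP => q1; [|case: ltnP => q2]) => //;
  apply: arrayE; rewrite /= ?addn1 ?addnn //; lia.
Qed.

Lemma rec_gramE (two_neq0 : 2%:R != 0 :> F) (s : bool) k p q :
    (s <= k)%N -> (p < dim_of s k)%N -> (q < dim_of s k)%N ->
  rec_eval (rec_history F (dim_of s) (gram_expr s) k) k p q (gram_expr s)
    = gram F k (label_at s k p) (label_at s k q).
Proof.
elim/nat_ind2: k p q => [||k IHk] p q le_sk lt_p lt_q; apply: gram_exprE => //.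
- by move=> i j; lia.
- by move=> i j; lia.
rewrite subSS subSS subn0 => i j range_i range_j.
have le_sk' : (s <= k)%N by lia.
have f_lt l : (0 < l <= k)%N -> (k + l - s.*2 < dim_of s k)%N by rewrite dim_ofE; lia.
have g_lt l : (0 < l <= k)%N -> (k.*2 + l - s.*2 < dim_of s k)%N by rewrite dim_ofE; lia.
have f_at l : (0 < l <= k)%N -> label_at s k (k + l - s.*2) = Lf l.
  by move=> range_l; rewrite /label_at ifF ?ifT; first congr Lf; lia.
have g_at l : (0 < l <= k)%N -> label_at s k (k.*2 + l - s.*2) = Lg l.
  by move=> range_l; rewrite /label_at !ifF; first congr Lg; lia.
have nth1E a b : (a < dim_of s k)%N -> (b < dim_of s k)%N ->
    nth (fun _ _ => 0) (rec_history F (dim_of s) (gram_expr s) k.+2) 1 a b =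
    gram F k (label_at s k a) (label_at s k b).
  move=> lt_a lt_b; rewrite -IHk //.
  by change (nth _ _ 1 a b) with
    (if (a < dim_of s k)%N && (b < dim_of s k)%N then
       rec_eval (rec_history F (dim_of s) (gram_expr s) k) k a b (gram_expr s)
     else 0); rewrite lt_a lt_b.
by rewrite !nth1E ?f_lt ?g_lt // !f_at ?g_at.
Qed.

End Recursion.

(** * Forms with given values on a basis, and the prime subfield *)

Section Forms.

Variables (F : fieldType) (V : vectType F).

Lemma hermitian_of_gram (eps : bool) n (b : n.-tuple V) (M : nat -> nat -> F) :
    basis_of fullv b -> (forall i j, M j i = (-1) ^+ eps * M i j) ->
  exists B : {hermitian V for eps & idfun},
    forall i j, (i < n)%N -> (j < n)%N -> B b`_i b`_j = M i j.
Proof.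
move=> basis_b symM.
pose f (u v : V) := \sum_(i < n) \sum_(j < n) coord b i u * coord b j v * M i j.
have f_bilin : bilinear_for ( *%R : GRing.Scale.law _ _) (idfun \; *%R : GRing.Scale.law _ _) f.
  split=> [v | u] a x y /=.
    rewrite /f mulr_sumr -big_split; apply: eq_bigr => i _ /=.
    rewrite mulr_sumr -big_split; apply: eq_bigr => j _ /=.
    by rewrite linearP /=; ring.
  rewrite /f mulr_sumr -big_split; apply: eq_bigr => i _ /=.
  rewrite mulr_sumr -big_split; apply: eq_bigr => j _ /=.
  by rewrite linearP /=; ring.
have f_herm u v : f u v = (-1) ^+ eps * idfun (f v u).
  rewrite /f /= exchange_big mulr_sumr; apply: eq_bigr => i _ /=.
  rewrite mulr_sumr; apply: eq_bigr => j _ /=.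
  by rewrite (symM i j); ring.
pose B : {hermitian V for eps & idfun} := HB.pack f
  (bilinear_isBilinear.Build F V V F _ _ f f_bilin)
  (isHermitianSesquilinear.Build F V eps idfun f f_herm).
have free_b := basis_free basis_b.
suff gramB (i j : 'I_n) : B b`_i b`_j = M i j.
  by exists B => i j lt_i lt_j; exact: gramB (Ordinal lt_i) (Ordinal lt_j).
rewrite /= /f (bigD1 i) //= [X in _ + X]big1 ?addr0 => [|i' ne_i'].
  rewrite (bigD1 j) //= big1 ?addr0 => [|j' ne_j'].
    by rewrite !coord_free // !eqxx !mul1r.
  by rewrite !coord_free // eq_sym -val_eqE in ne_j' *; rewrite (negPf ne_j') mulr0 mul0r.
rewrite big1 // => j' _; rewrite !coord_free //.
by rewrite eq_sym -val_eqE in ne_i' *; rewrite (negPf ne_i') !mul0r.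
Qed.

End Forms.

Section PrimeSubfield.
Variable F : fieldType.

Lemma prime_subfield0 : prime_subfield (0 : F).
Proof. by rewrite -(subrr 1); do !constructor. Qed.

Lemma prime_subfieldN (x : F) : prime_subfield x -> prime_subfield (- x).
Proof. by rewrite -sub0r; constructor; first exact: prime_subfield0. Qed.

Lemma prime_subfieldD (x y : F) :
  prime_subfield x -> prime_subfield y -> prime_subfield (x + y).
Proof. by move=> Px Py; rewrite -[y]opprK; constructor=> //; apply: prime_subfieldN. Qed.

Lemma prime_subfieldI (x : F) : prime_subfield x -> prime_subfield x^-1.
Proof. by rewrite -div1r; constructor=> //; constructor. Qed.

Lemma prime_subfieldM (x y : F) :
  prime_subfield x -> prime_subfield y -> prime_subfield (x * y).
Proof. by move=> Px Py; rewrite -[y]invrK; constructor=> //; apply: prime_subfieldI. Qed.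

Lemma prime_subfield_int (z : int) : prime_subfield (z%:~R : F).
Proof.
have nat_prime n : prime_subfield (n%:R : F).
  elim: n => [|n IHn]; first exact: prime_subfield0.
  by rewrite -addn1 natrD; apply: prime_subfieldD => //; constructor.
by case: z => n; [apply: nat_prime | apply: prime_subfieldN; apply: nat_prime].
Qed.

(** Recursions only use integers and field operations. *)
Lemma rec_eval_prime_subfield (h : seq (nat -> nat -> F)) k i j r :
    (forall d a b, prime_subfield (nth (fun _ _ => 0) h d a b)) ->
  prime_subfield (rec_eval h k i j r).
Proof.
move=> h_prime; elim: r => //=.
- exact: prime_subfield_int.
- by move=> s Ps t Pt; apply: prime_subfieldD.
- by move=> s Ps; apply: prime_subfieldN.
- by move=> s Ps t Pt; apply: prime_subfieldM.
- by move=> s Ps; apply: prime_subfieldI.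
by move=> a b s Ps t Pt; case: (_ <= _)%N.
Qed.

Lemma rec_mx_prime_subfield dim r k i j :
  prime_subfield (rec_mx F dim r k i j).
Proof.
rewrite mxE; apply: rec_eval_prime_subfield.
elim: k {i j} => [|k IHk] d a b; first by rewrite nth_nil; exact: prime_subfield0.
case: d => [|d]; last exact: IHk.
rewrite (_ : nth _ _ _ a b = if (a < dim k)%N && (b < dim k)%N
  then rec_eval (rec_history F dim r k) k a b r else 0) //.
by case: ifP => _; [exact: rec_eval_prime_subfield | exact: prime_subfield0].
Qed.

End PrimeSubfield.

(** * Spans and standard bases *)

Section Coordinates.

Variables (F : fieldType) (V : vectType F).

Lemma mem_span_map (u : nat -> V) r v : uniq r -> v \in <<[seq u i | i <- r]>>%VS ->
  exists2 x : nat -> F, (forall i, i \notin r -> x i = 0) & v = \sum_(i <- r) x i *: u i.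
Proof.
elim: r v => [|i r IHr] v /=.
  by rewrite span_nil memv0 => _ /eqP->; exists (fun=> 0); rewrite ?big_nil.
case/andP=> i_notin uniq_r; rewrite span_cons => /memv_addP[_ /vlineP[c ->] [v' v'_in ->]].
have [x x0 ->] := IHr v' uniq_r v'_in.
exists (fun j => if j == i then c else x j) => [j|].
  by rewrite inE negb_or => /andP[/negPf-> /x0].
rewrite big_cons eqxx; congr (_ + _); rewrite !big_seq; apply: eq_bigr => j j_in.
by case: eqP => // eq_ji; rewrite -eq_ji j_in in i_notin.
Qed.

(** Coefficients are functions on all indices that vanish off the range, so
    that combinations over different ranges can be added and shifted. *)
Lemma mem_span_vecs (u : nat -> V) a b n v :
    (0 < a <= b.+1)%N -> (b < n)%N -> v \in <<vecs a b u>>%VS ->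
  exists2 x : nat -> F, (forall i, ~~ (a <= i <= b)%N -> x i = 0) &
    v = \sum_(1 <= i < n) x i *: u i.
Proof.
move=> /andP[a_gt0 le_ab] lt_bn /mem_span_map[|x x0 ->]; first exact: iota_uniq.
have {}x0 i : ~~ (a <= i <= b)%N -> x i = 0.
  by move=> i_out; apply: x0; rewrite mem_index_iota ltnS.
have sum0 c d : (d <= a)%N || (b < c)%N -> \sum_(c <= i < d) x i *: u i = 0.
  by move=> cd; rewrite big_nat_cond big1 // => i range_i; rewrite x0 ?scale0r //; lia.
exists x => //; rewrite (big_cat_nat a_gt0) ?(leq_trans le_ab) //=.
by rewrite [in RHS](big_cat_nat le_ab) //= (sum0 1%N a) ?leqnn // add0r
  (sum0 b.+1 n) ?ltnSn ?orbT // addr0.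
Qed.

Lemma mem_orthov_span eps (B : {hermitian V for eps & idfun}) X v :
  reflect (forall x, x \in X -> B v x = 0) (v \in orthov B <<X>>%VS).
Proof.
apply: (iffP mem_orthovP) => [vX0 x x_in | vX0 w].
  by apply: vX0; apply: memv_span.
rewrite -[X]in_tupleE => /coord_span->; rewrite linear_sumr big1 // => i _.
by rewrite linearZr_LR /= vX0 ?mulr0 // mem_nth.
Qed.

(** The second hypothesis replaces a dimension count: it is obtained below
    from the coordinates of v. *)
Lemma orthov_spanE eps (B : {hermitian V for eps & idfun}) X Y :
    (forall y x, y \in Y -> x \in X -> B y x = 0) ->
    (forall v, (forall x, x \in X -> B v x = 0) -> v \in <<Y>>%VS) ->
  <<Y>>%VS = orthov B <<X>>%VS.
Proof.
move=> YX0 XY; apply/eqP; rewrite eqEsubv; apply/andP; split.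
  by apply/span_subvP => y y_in; apply/mem_orthov_span => x; apply: YX0.
by apply/subvP => v /mem_orthov_span; apply: XY.
Qed.

Lemma mem_vecs (u : nat -> V) a b v :
  reflect (exists2 i, (a <= i <= b)%N & v = u i) (v \in vecs a b u).
Proof.
by apply: (iffP mapP) => -[i]; rewrite ?mem_index_iota ?ltnS => range_i ->; exists i;
  rewrite ?mem_index_iota.
Qed.

Lemma mem_vec (u : nat -> V) a b i : (a <= i <= b)%N -> u i \in vecs a b u.
Proof. by move=> range_i; apply/mem_vecs; exists i. Qed.

End Coordinates.

Definition standard_basis (T : Type) (s : bool) k (e f g : nat -> T) : seq T :=
  vecs s.+1 (k.+1 - s) e ++ vecs 1 k f ++ vecs 1 k g.

Definition vector_of (T : Type) (e f g : nat -> T) (l : label) : T :=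
  match l with Le i => e i | Lf i => f i | Lg i => g i end.

Definition valid_label (s : bool) (k : nat) (l : label) : bool :=
  match l with
  | Le i => (s < i <= k.+1 - s)%N
  | Lf i | Lg i => (0 < i <= k)%N
  end.

Definition position (s : bool) (k : nat) (l : label) : nat :=
  match l with
  | Le i => i - s.+1
  | Lf i => k + i - s.*2
  | Lg i => k.*2 + i - s.*2
  end.

Lemma label_at_position (s : bool) k l : (s <= k)%N -> valid_label s k l ->
  label_at s k (position s k l) = l.
Proof.
rewrite /label_at; case: l => i le_sk /= range_i.
- by rewrite ifT; first congr Le; lia.
- by rewrite ifF ?ifT; first congr Lf; lia.
by rewrite !ifF; first congr Lg; lia.
Qed.

Lemma position_lt (s : bool) k l : (s <= k)%N -> valid_label s k l ->
  (position s k l < dim_of s k)%N.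
Proof. by rewrite dim_ofE; case: l => i /=; lia. Qed.

Lemma size_standard_basis (T : Type) (s : bool) k (e f g : nat -> T) : (s <= k)%N ->
  size (standard_basis s k e f g) = dim_of s k.
Proof. by move=> le_sk; rewrite dim_ofE !size_cat !size_map !size_iota; lia. Qed.

Lemma nth_standard_basis (T : Type) x0 (s : bool) k (e f g : nat -> T) p : (s <= k)%N ->
    (p < dim_of s k)%N ->
  nth x0 (standard_basis s k e f g) p = vector_of e f g (label_at s k p).
Proof.
rewrite dim_ofE => le_sk lt_p; rewrite /label_at !nth_cat !size_map !size_iota.
have -> : ((k.+1 - s).+1 - s.+1 = k.+1 - s.*2)%N by lia.
case: ltnP => p1.
  by rewrite (nth_map 0%N) ?nth_iota ?size_iota //=; first congr e; lia.
have -> : (p - (k.+1 - s.*2) < k.+1 - 1 = (p < k.*2.+1 - s.*2))%N by apply/idP/idP; lia.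
case: ltnP => p2.
  by rewrite (nth_map 0%N) ?nth_iota ?size_iota //=; first congr f; lia.
by rewrite (nth_map 0%N) ?nth_iota ?size_iota //=; first congr g; lia.
Qed.

(** * The orthogonals of the subspaces I *)

Section Duality.

Variables (F : fieldType) (V : vectType F) (s : bool) (k : nat) (e f g : nat -> V).
Hypothesis two_neq0 : 2%:R != 0 :> F.
Hypothesis le_sk : (s <= k)%N.
Hypothesis basis_efg : basis_of fullv (standard_basis s k e f g).

Let vec := vector_of e f g.

Variables (eps : bool) (B : {hermitian V for eps & idfun}).
Hypothesis gramB : forall l m, valid_label s k l -> valid_label s k m ->
  B (vec l) (vec m) = gram F k l m.

Let A := array F k.

(** With e_1 = 0 in type A(3k-1,0) and f_0 = 0 in both types, I_1 is spanned
    by the f_i - e_i and C_3 by the e_i - f_{i-1} and the f_i - g_i, whatever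
    the type. *)
Definition e_pad (i : nat) : V := if valid_label s k (Le i) then e i else 0.
Definition f_pad (i : nat) : V := if valid_label s k (Lf i) then f i else 0.

Definition supported (l : nat -> label) (x : nat -> F) : Prop :=
  forall i, ~~ valid_label s k (l i) -> x i = 0.

Definition combination (x y z : nat -> F) : V :=
  \sum_(1 <= i < k.+2) (x i *: e i + y i *: f i + z i *: g i).

Lemma combinationP v : exists x y z,
  [/\ supported Le x, supported Lf y, supported Lg z & v = combination x y z].
Proof.
have : v \in <<standard_basis s k e f g>>%VS by rewrite (span_basis basis_efg) memvf.
have e_range : (0 < s.+1 <= (k.+1 - s).+1)%N by lia.
have e_lt : (k.+1 - s < k.+2)%N by lia.
have fg_range : (0 < 1 <= k.+1)%N by [].
have fg_lt : (k < k.+2)%N by lia.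
rewrite !span_cat => /memv_addP[ve /(mem_span_vecs e_range e_lt)[x x0 ->] [w]].
move=> /memv_addP[vf /(mem_span_vecs fg_range fg_lt)[y y0 ->] [vg]].
move=> /(mem_span_vecs fg_range fg_lt)[z z0 ->] -> ->.
by exists x, y, z; split=> //; rewrite /combination !big_split addrA.
Qed.

Section Combination.

Variables x y z : nat -> F.
Hypotheses (x0 : supported Le x) (y0 : supported Lf y) (z0 : supported Lg z).

Let v := combination x y z.

Lemma form_combination m : valid_label s k m ->
  B v (vec m) = \sum_(1 <= i < k.+2)
    (x i * gram F k (Le i) m + y i * gram F k (Lf i) m + z i * gram F k (Lg i) m).
Proof.
move=> valid_m; rewrite /v /combination linear_sumlz /=.
have gramZ l c : (~~ valid_label s k l -> c = 0) ->
    B (c *: vec l) (vec m) = c * gram F k l m.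
  move=> c0; rewrite linearZl_LR /=; have [/gramB->//|/c0->] := boolP (valid_label s k l).
  by rewrite !mul0r.
apply: eq_bigr => i _; rewrite !linearDl.
by congr (_ + _ + _); [exact: (gramZ (Le i) _ (@x0 i)) | exact: (gramZ (Lf i) _ (@y0 i))
  | exact: (gramZ (Lg i) _ (@z0 i))].
Qed.

(** Moves B(g_i, f_j) = A(i+1, j) to row i+1, where it meets the
    contributions of e_{i+1} and f_{i+1}. *)
Lemma sum_shift (c : nat -> F) j : supported Lf c ->
  \sum_(1 <= i < k.+2) c i * A i.+1 j = \sum_(1 <= i < k.+2) c i.-1 * A i j.
Proof.
move=> c0; rewrite big_nat_recr //= [c k.+1]c0 /= ?ltnn ?andbF // mul0r addr0.
by rewrite [RHS]big_ltn // c0 // mul0r add0r [RHS]big_add1.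
Qed.

Lemma form_e j : (s < j <= k.+1 - s)%N ->
  B v (e j) = \sum_(1 <= i < k.+2) (x i + y i) * A i j.
Proof.
move=> range_j; rewrite (form_combination (m := Le j)) //.
by apply: eq_bigr => i _; rewrite /= mulr0 addr0 mulrDl.
Qed.

Lemma form_f j : (0 < j <= k)%N ->
  B v (f j) = \sum_(1 <= i < k.+2) (x i + y i + z i.-1) * A i j.
Proof.
move=> range_j; rewrite (form_combination (m := Lf j)) //.
rewrite big_split /= sum_shift // -big_split.
by apply: eq_bigr => i _; rewrite /= -!mulrDl.
Qed.

Lemma form_g j : (0 < j <= k)%N ->
  B v (g j) = \sum_(1 <= i < k.+2) y i * A i j.+1.
Proof.
move=> range_j; rewrite (form_combination (m := Lg j)) //.
by apply: eq_bigr => i _; rewrite /= !mulr0 addr0 add0r.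
Qed.

(** Here f_j and e_j cancel on the vectors e and f.  If e_j is replaced by 0,
    then j = 1, and the first column of A vanishes but for its last entry,
    which only meets g_k. *)
Lemma form_fe j : (0 < j <= k)%N ->
  B v (f j - e_pad j) = \sum_(1 <= i < k.+2) z i.-1 * A i j.
Proof.
move=> range_j; rewrite linearBr /= /e_pad; case: ifP => [valid_j | inv_j].
  by rewrite form_e // form_f // -sumrB; apply: eq_bigr => i _; ring.
rewrite linear0r /= subr0 form_f //; apply: eq_big_nat => i range_i.
have [le_ik | gt_ik] := leqP i k.
  have -> : j = 1%N by move: inv_j => /=; lia.
  by rewrite /A array_sym array_row1 // !mulr0.
rewrite x0 /= ?y0 /= ?add0r //; try lia.
by move: inv_j => /=; lia.
Qed.

(** The recurrence turns the difference of B(f_i, f_j) and B(f_i, g_j) into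
    A(i+1, j), so f_{i-1}, g_{i-1} and e_i contribute alike. *)
Lemma form_fg j : (0 < j <= k)%N ->
  B v (f j - g j) = \sum_(1 <= i < k.+2) (x i + y i.-1 + z i.-1) * A i j.
Proof.
move=> range_j; rewrite linearBr /= form_f // form_g // -sumrB.
transitivity (\sum_(1 <= i < k.+2) ((x i + z i.-1) * A i j + y i * A i.+1 j)).
  apply: eq_big_nat => i range_i; have [le_ik | gt_ik] := leqP i k.
    by rewrite /A (array_rec two_neq0 (i := i)) //; [ring | lia].
  by rewrite y0 /=; [ring | lia].
by rewrite big_split /= sum_shift // -big_split; apply: eq_bigr => i _; rewrite /=; ring.
Qed.

(** The four statements below are triangularity, for the columns 2 to k+1, 1
    to k, s+1 to k+1-s and 1 to k respectively. *)
Lemma coef_f_eq0 : (forall j, (0 < j <= k)%N -> B v (g j) = 0) -> forall i, y i = 0.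
Proof.
move=> vg0 i; have [i_gt0 | ] := boolP (0 < i)%N; last by move=> ?; apply: y0 => /=; lia.
apply: (@array_triangular _ two_neq0 k 2 k.+1) => // [i' lt_i' | [//|j] range_j|].
- by apply: y0 => /=; lia.
- by rewrite -form_g ?vg0 //; lia.
by lia.
Qed.

Lemma coef_g_eq0 : (forall j, (0 < j <= k)%N -> B v (f j - e_pad j) = 0) ->
  forall i, z i = 0.
Proof.
move=> vfe0 i; have [i_gt0 | ] := boolP (0 < i)%N; last by move=> ?; apply: z0 => /=; lia.
apply: (@array_triangular _ two_neq0 k 1 k (z \o predn) _ _ _ i.+1) => //
  [i' lt_i' | j range_j|].
- by apply: z0 => /=; lia.
- by rewrite -form_fe ?vfe0.
by lia.
Qed.

Lemma coef_e_eq0 : (forall i, y i = 0) ->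
  (forall j, (s < j <= k.+1 - s)%N -> B v (e j) = 0) -> forall i, x i = 0.
Proof.
move=> y_0 ve0 i; have [valid_i | ] := boolP (valid_label s k (Le i)); last exact: x0.
move: valid_i => /= valid_i.
apply: (@array_triangular _ two_neq0 k s.+1 (k.+1 - s)%N) => // [i' lt_i' | j range_j||].
- by apply: x0 => /=; lia.
- rewrite -[RHS](ve0 j) // form_e //; apply: eq_bigr => i' _; rewrite y_0 addr0 //.
- by lia.
by lia.
Qed.

Lemma coef_sum_eq0 : (forall j, (0 < j <= k)%N -> B v (f j - g j) = 0) ->
  forall i, (1 < i)%N -> x i + y i.-1 + z i.-1 = 0.
Proof.
move=> vfg0 i i_gt1.
apply: (@array_triangular _ two_neq0 k 1 k (fun i => x i + y i.-1 + z i.-1)) => //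
  [i' lt_i' | j range_j||]; try lia.
- by rewrite x0 /= ?y0 ?z0 /= ?addr0 //; lia.
- by rewrite -form_fg ?vfg0.
Qed.

End Combination.

Lemma mem_combination (U : {vspace V}) x y z :
    supported Le x -> supported Lf y -> supported Lg z ->
    (forall i, valid_label s k (Le i) -> x i *: e i \in U) ->
    (forall i, valid_label s k (Lf i) -> y i *: f i + z i *: g i \in U) ->
  combination x y z \in U.
Proof.
move=> x0 y0 z0 xU yzU; apply: memv_suml => i _; rewrite -addrA memvD //.
  by have [/xU | /x0->] := boolP (valid_label s k (Le i)); rewrite // scale0r mem0v.
have [/yzU// | inv_i] := boolP (valid_label s k (Lf i)).
by rewrite y0 ?z0 // !scale0r addr0 mem0v.
Qed.

Lemma orthov_I2 :
  <<vecs s.+1 (k.+1 - s) e ++ vecs 1 k g>>%VS = orthov B <<vecs 1 k g>>%VS.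
Proof.
apply: orthov_spanE => [u w | u u_orth].
  rewrite mem_cat => u_in /mem_vecs[j range_j ->]; case/orP: u_in => /mem_vecs[i range_i ->].
    exact: (gramB (l := Le i) (m := Lg j)).
  exact: (gramB (l := Lg i) (m := Lg j)).
have [x [y [z [x0 y0 z0 def_u]]]] := combinationP u; rewrite def_u in u_orth *.
have y_0 := coef_f_eq0 x0 y0 z0 (fun _ range_j => u_orth _ (mem_vec _ range_j)).
apply: mem_combination => // i valid_i; rewrite ?y_0 ?scale0r ?add0r memvZ // memv_span //.
  by rewrite mem_cat mem_vec.
by rewrite mem_cat mem_vec ?orbT.
Qed.

Lemma orthov_I1 :
  <<vecs s.+1 (k.+1 - s) e ++ vecs 1 k f>>%VS
    = orthov B <<vecs 1 k (fun i => f i - e_pad i)>>%VS.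
Proof.
apply: orthov_spanE => [u w | u u_orth].
  rewrite mem_cat => u_in /mem_vecs[j range_j ->].
  rewrite linearBr /= /e_pad; case: ifP => [valid_j | inv_j].
    case/orP: u_in => /mem_vecs[i range_i ->].
      by rewrite (gramB (l := Le i) (m := Lf j)) // (gramB (l := Le i) (m := Le j)) // subrr.
    by rewrite (gramB (l := Lf i) (m := Lf j)) // (gramB (l := Lf i) (m := Le j)) // subrr.
  have -> : j = 1%N by move: inv_j => /=; lia.
  rewrite linear0r /= subr0; case/orP: u_in => /mem_vecs[i range_i ->].
    rewrite (gramB (l := Le i) (m := Lf 1)) /= ?array_eq0 //; try lia.
    by move: inv_j => /=; lia.
  by rewrite (gramB (l := Lf i) (m := Lf 1)) /= ?array_eq0 //; lia.
have [x [y [z [x0 y0 z0 def_u]]]] := combinationP u; rewrite def_u in u_orth *.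
have z_0 := coef_g_eq0 x0 y0 z0 (fun _ range_j => u_orth _ (mem_vec _ range_j)).
apply: mem_combination => // i valid_i; rewrite ?z_0 ?scale0r ?addr0 memvZ // memv_span //.
  by rewrite mem_cat mem_vec.
by rewrite mem_cat mem_vec ?orbT.
Qed.

(** The vector x_i e_i + (- x_i - z) f_{i-1} + z g_{i-1} equals
    x_i (e_i - f_{i-1}) - z (f_{i-1} - g_{i-1}), so the relation of
    [coef_sum_eq0] puts a vector orthogonal to I_3 into C_3. *)
Lemma orthov_I3 :
  <<vecs s.+1 (k.+1 - s) (fun i => e i - f_pad i.-1) ++ vecs 1 k (fun i => f i - g i)>>%VS
    = orthov B <<vecs 1 k (fun i => f i - g i)>>%VS.
Proof.
apply: orthov_spanE => [u w | u u_orth].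
  rewrite mem_cat => u_in /mem_vecs[j range_j ->]; case/orP: u_in => /mem_vecs[i range_i ->].
    rewrite linearBl !linearBr /=.
    rewrite (gramB (l := Le i) (m := Lf j)) // (gramB (l := Le i) (m := Lg j)) //=.
    rewrite subr0 (_ : B (f_pad i.-1) (f j) - _ = array F k i.-1 j - array F k i.-1 j.+1).
      rewrite (array_rec two_neq0 (i := i.-1)) ?prednK; [ring | lia..].
    rewrite /f_pad; case: ifP => [valid_i | inv_i].
      by rewrite (gramB (l := Lf _) (m := Lf j)) // (gramB (l := Lf _) (m := Lg j)).
    have -> : i = 1%N by move: inv_i => /=; lia.
    by rewrite !linear0l !array0l.
  rewrite linearBl !linearBr /=.
  rewrite (gramB (l := Lf i) (m := Lf j)) // (gramB (l := Lf i) (m := Lg j)) //=.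
  rewrite (gramB (l := Lg i) (m := Lf j)) // (gramB (l := Lg i) (m := Lg j)) //=.
  rewrite (array_rec two_neq0); [ring | lia | lia].
have [x [y [z [x0 y0 z0 def_u]]]] := combinationP u; rewrite def_u in u_orth *.
have xyz_0 := coef_sum_eq0 x0 y0 z0 (fun _ range_j => u_orth _ (mem_vec _ range_j)).
have def_y i : (0 < i)%N -> y i = - x i.+1 - z i.
  by move=> i_gt0; apply/eqP; rewrite -subr_eq0 -[X in _ == X](xyz_0 i.+1) //=; apply/eqP; ring.
have shift_x : \sum_(1 <= i < k.+2) x i.+1 *: f i = \sum_(1 <= i < k.+2) x i *: f_pad i.-1.
  rewrite big_nat_recr //= (x0 k.+2) /= ?scale0r ?addr0; last by lia.
  rewrite [RHS]big_ltn // scaler0 add0r [RHS]big_add1 /=.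
  by apply: eq_big_nat => i range_i; rewrite /f_pad /= ifT; last by lia.
have -> : combination x y z =
    \sum_(1 <= i < k.+2) (x i *: (e i - f_pad i.-1) - z i *: (f i - g i)).
  rewrite sumrB; under [X in _ = X - _]eq_bigr do rewrite scalerBr.
  rewrite sumrB -shift_x -!sumrB; apply: eq_big_nat => i range_i.
  rewrite def_y; last by lia.
  rewrite scalerBl scaleNr scalerBr opprB -!addrA; congr (_ + (_ + _)).
  by rewrite addrC.
rewrite memv_suml // => i _; apply: memvB.
  have [valid_i | /x0->] := boolP (valid_label s k (Le i)); last by rewrite scale0r mem0v.
  by rewrite memvZ // memv_span // mem_cat (mem_vec (fun i => e i - f_pad i.-1)).
have [valid_i | /z0->] := boolP (valid_label s k (Lg i)); last by rewrite scale0r mem0v.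
by rewrite memvZ // memv_span // mem_cat (mem_vec (fun i => f i - g i)) ?orbT.
Qed.

Lemma nondegenerate_form : nondegenerate B.
Proof.
rewrite /nondegenerate -subv0; apply/subvP => u /mem_orthovP u_orth.
have {}u_orth w : B u w = 0 by apply: u_orth; exact: memvf.
have [x [y [z [x0 y0 z0 def_u]]]] := combinationP u; rewrite def_u in u_orth *.
have y_0 := coef_f_eq0 x0 y0 z0 (fun j _ => u_orth (g j)).
have z_0 := coef_g_eq0 x0 y0 z0 (fun j _ => u_orth (f j - e_pad j)).
have x_0 := coef_e_eq0 x0 y0 z0 y_0 (fun j _ => u_orth (e j)).
by apply: mem_combination => // i _; rewrite ?x_0 ?y_0 ?z_0 !scale0r ?addr0 mem0v.
Qed.

End Duality.

(** * Both types of sextuples *)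

Lemma gram_sym (F : fieldType) k l m :
  gram F k m l = (-1) ^+ odd k * gram F k l m.
Proof. by case: l m => [i|i|i] [j|j|j] /=; rewrite ?mulr0 // -array_sym. Qed.

Lemma gram_form (F : fieldType) (two_neq0 : 2%:R != 0 :> F) (s : bool)
    (V : vectType F) k (e f g : nat -> V) :
    (s <= k)%N -> basis_of fullv (standard_basis s k e f g) ->
  exists B : {hermitian V for odd k & idfun},
    (forall l m, valid_label s k l -> valid_label s k m ->
       B (vector_of e f g l) (vector_of e f g m) = gram F k l m) /\
    coordinate_matrix B (standard_basis s k e f g) (rec_mx F (dim_of s) (gram_expr s) k).
Proof.
move=> le_sk basis_efg.
pose M p q := gram F k (label_at s k p) (label_at s k q).
have size_b := size_standard_basis e f g le_sk.
have [B gramB] := @hermitian_of_gram F V (odd k) _ (Tuple (introT eqP size_b)) M basis_efg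
  (fun p q => gram_sym F k _ _).
exists B; split=> [l m valid_l valid_m|].
  have := gramB _ _ (position_lt le_sk valid_l) (position_lt le_sk valid_m).
  by rewrite /M !nth_standard_basis ?position_lt // !label_at_position.
by split=> // p q; rewrite mxE rec_gramE //; exact: gramB.
Qed.

Section Spans.

Variables (F : fieldType) (V : vectType F).
Implicit Types u w : nat -> V.

Lemma eq_vecs u w a b : (forall i, (a <= i <= b)%N -> u i = w i) ->
  vecs a b u = vecs a b w.
Proof. by move=> eq_uw; apply/eq_in_map => i; rewrite mem_index_iota => /eq_uw. Qed.

Lemma vecs_cons u a b : (a <= b)%N -> vecs a b u = u a :: vecs a.+1 b u.
Proof. by move=> le_ab; rewrite /vecs /index_iota subSn. Qed.

Lemma vecs_shift u a b : vecs a.+1 b.+1 u = vecs a b (fun i => u i.+1).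
Proof. by rewrite /vecs /index_iota subSS -[a.+1]add1n iotaDl -map_comp. Qed.

Lemma span_vecs_opp u w a b : (forall i, (a <= i <= b)%N -> u i = - w i) ->
  <<vecs a b u>>%VS = <<vecs a b w>>%VS.
Proof.
move=> eq_uw; apply/eqP; rewrite eqEsubv; apply/andP.
split; apply/span_subvP => _ /mem_vecs[i range_i ->].
  by rewrite eq_uw // memvN memv_span // mem_vec.
by rewrite -memvN -eq_uw // memv_span // mem_vec.
Qed.

End Spans.

Lemma standard_plus_compatible (F : fieldType) (two_neq0 : 2%:R != 0 :> F)
    (V : vectType F) k (S : sextuple V) (e f g : nat -> V) :
    standard_plus k S e f g ->
  exists B : {hermitian V for odd k & idfun},
    compatible S B /\
    coordinate_matrix B (basis_plus k e f g) (rec_mx F dim_plus (gram_expr false) k).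
Proof.
case=> basis_efg [I1 I2 I3] [C1 C2 C3].
have le_sk : (false <= k)%N by [].
have {}basis_efg : basis_of fullv (standard_basis false k e f g) by [].
have [B [gramB coordB]] := @gram_form F two_neq0 false V k e f g le_sk basis_efg.
exists B; split=> //; split.
- exact: (nondegenerate_form two_neq0 le_sk basis_efg gramB).
- rewrite C1 I1 (@span_vecs_opp _ _ _ (fun i => f i - e_pad false k e i)) => [|i range_i].
    exact: (orthov_I1 two_neq0 le_sk basis_efg gramB).
  by rewrite /e_pad ifT ?opprB //=; lia.
- by rewrite C2 I2; exact: (orthov_I2 two_neq0 le_sk basis_efg gramB).
rewrite C3 I3 -(orthov_I3 two_neq0 le_sk basis_efg gramB).
rewrite [in RHS](@vecs_cons _ _ _ 1) //= /f_pad /= subr0; congr <<_ :: _ ++ _>>%VS.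
rewrite subn0 vecs_shift; apply: eq_vecs => i range_i /=.
by rewrite /f_pad /= ifT //.
Qed.

Lemma standard_minus_compatible (F : fieldType) (two_neq0 : 2%:R != 0 :> F)
    (V : vectType F) k (S : sextuple V) (e f g : nat -> V) : (1 <= k)%N ->
    standard_minus k S e f g ->
  exists B : {hermitian V for odd k & idfun},
    compatible S B /\
    coordinate_matrix B (basis_minus k e f g) (rec_mx F dim_minus (gram_expr true) k).
Proof.
move=> k_gt0 [basis_efg [I1 I2 I3] [C1 C2 C3]].
have le_sk : (true <= k)%N by [].
have basisE : basis_minus k e f g = standard_basis true k e f g.
  by rewrite /standard_basis subn1.
rewrite basisE in basis_efg *.
have [B [gramB coordB]] := @gram_form F two_neq0 true V k e f g le_sk basis_efg.
exists B; split=> //; split.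
- exact: (nondegenerate_form two_neq0 le_sk basis_efg gramB).
- have := orthov_I1 two_neq0 le_sk basis_efg gramB; rewrite subn1 /= C1 I1 => ->.
  rewrite vecs_cons // /e_pad /= subr0; congr (orthov B <<_ :: _>>)%VS.
  by apply: eq_vecs => i range_i; rewrite ifT //=; lia.
- by have := orthov_I2 two_neq0 le_sk basis_efg gramB; rewrite subn1 /= C2 I2.
rewrite C3 I3 -(orthov_I3 two_neq0 le_sk basis_efg gramB) subn1 !span_cat; congr (_ + _)%VS.
case: k k_gt0 {le_sk basisE basis_efg gramB coordB B I1 I2 I3 C1 C2 C3} => // k _.
rewrite vecs_shift; apply: span_vecs_opp => i range_i.
by rewrite /f_pad /= ifT ?opprB //; lia.
Qed.

Theorem theorem5p3 (F : fieldType) (perfectF : perfect_field F)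
    (char_neq2 : 2%N \notin [pchar F]) :
  [/\ (forall (k : nat) (V : vectType F) (S : sextuple V),
         type_plus k S ->
         exists B : {hermitian V for odd k & idfun}, compatible S B),
      (forall (k : nat) (V : vectType F) (S : sextuple V),
         (1 <= k)%N -> type_minus k S ->
         exists B : {hermitian V for odd k & idfun}, compatible S B),
      (exists r : recursion, forall k : nat,
         (forall i j, prime_subfield (rec_mx F dim_plus r k i j)) /\
         forall (V : vectType F) (S : sextuple V) (e f g : nat -> V),
           standard_plus k S e f g ->
           exists B : {hermitian V for odd k & idfun},
             compatible S B /\
             coordinate_matrix B (basis_plus k e f g)
               (rec_mx F dim_plus r k)) &
      (exists r : recursion, forall k : nat, (1 <= k)%N ->
         (forall i j, prime_subfield (rec_mx F dim_minus r k i j)) /\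
         forall (V : vectType F) (S : sextuple V) (e f g : nat -> V),
           standard_minus k S e f g ->
           exists B : {hermitian V for odd k & idfun},
             compatible S B /\
             coordinate_matrix B (basis_minus k e f g)
               (rec_mx F dim_minus r k))].
Proof.
have two_neq0 : 2%:R != 0 :> F by move: char_neq2; rewrite inE.
split.
- move=> k V S [e [f [g std]]].
  by have [B [compB _]] := standard_plus_compatible two_neq0 std; exists B.
- move=> k V S k_gt0 [e [f [g std]]].
  by have [B [compB _]] := standard_minus_compatible two_neq0 k_gt0 std; exists B.
- exists (gram_expr false) => k; split=> [i j | V S e f g]; first exact: rec_mx_prime_subfield.
  exact: standard_plus_compatible.
- exists (gram_expr true) => k k_gt0; split=> [i j | V S e f g].
    exact: rec_mx_prime_subfield.
  exact: standard_minus_compatible.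
Qed.
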